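(* Let $0<p,q<\infty$. Let $a=\{a(m)\}_{m\in\mathbb N}$, $b=\{b(m)\}_{m\in\mathbb N}$ and $u=\{u(m)\}_{m\in\mathbb N}$ be given sequences of non-negative real numbers with $b(1)>0$ and $B(\infty):=\sum_{k=1}^\infty b(k)<\infty$. Consider the inequality $$\bigg(\sum_{m=1}^{\infty}\bigg(\sup_{m\le i<\infty}u(i)\sum_{k=1}^{i}x(k)\bigg)^q a(m)\bigg)^{\frac1q}\le C\bigg(\sum_{m=1}^\infty x(m)^p b(m)\bigg)^{\frac1p}.\qquad( * )$$ Then $( * )$ holds, with some finite constant $C$ independent of $x$, for all non-negative, non-increasing sequences $x=\{x(m)\}_{m\in\mathbb N}$ if and only if $$C_0:=\bigg(\sum_{m=1}^\infty\Big(\sup_{m\le i<\infty}u(i)\,i\Big)^q a(m)\bigg)^{\frac1q}B(\infty)^{-\frac1p}<\infty .$$ Moreover, if $C$ denotes the best constant in $( * )$, then $$C_0\le C\le C_0\,b(1)^{-\frac1p}B(\infty)^{\frac1p}.$$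
   Context: $\mathbb N=\{1,2,3,\dots\}$. All sequences have finite non-negative real entries; sums and suprema are taken in $[0,\infty]$. Conventions: $0\cdot\infty=0$, $0/0=0$, $\infty/\infty=0$, $1/0=\infty$, $1/\infty=0$; $\infty^\alpha=\infty$ for $\alpha>0$ and $\infty^\alpha=0$ for $\alpha<0$. The best constant in $( * )$ is the infimum of all finite $C$ for which $( * )$ holds for all non-negative, non-increasing sequences $x$, and it equals $\infty$ if there is no such $C$. *)

(* Defs.v *)
From mathcomp Require Import all_boot all_order all_algebra.
From mathcomp Require Import all_classical all_reals all_analysis.

Set Implicit Arguments.
Unset Strict Implicit.
Unset Printing Implicit Defensive.

Import Order.TTheory GRing.Theory Num.Theory.

Local Open Scope classical_set_scope.
Local Open Scope ring_scope.
Local Open Scope ereal_scope.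

(* Sequences are indexed by {1, 2, 3, ...}: they are functions on [nat] whose
   value at index 0 is never used nor constrained. *)

Definition nonneg_seq (R : realType) (x : nat -> R) : Prop :=
  forall m : nat, (0 < m)%N -> (0 <= x m)%R.

Definition nonincr_seq (R : realType) (x : nat -> R) : Prop :=
  forall m n : nat, (0 < m)%N -> (m <= n)%N -> (x n <= x m)%R.

Definition seq_sum (R : realType) (b : nat -> R) : \bar R :=
  \sum_(1 <= k <oo) (b k)%:E.

Definition tail_sup (R : realType) (v : nat -> R) (m : nat) : \bar R :=
  ereal_sup [set (v i)%:E | i in [set i : nat | (m <= i)%N]].

Definition hardy_lhs (R : realType) (q : R) (a u x : nat -> R) : \bar R :=
  (\sum_(1 <= m <oo)
     tail_sup (fun i => u i * \sum_(1 <= k < i.+1) x k)%R m `^ q * (a m)%:E)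
  `^ q^-1.

Definition hardy_rhs (R : realType) (p : R) (b x : nat -> R) : \bar R :=
  (\sum_(1 <= m <oo) ((x m `^ p)%R * b m)%:E) `^ p^-1.

Definition hardy_ineq (R : realType) (p q : R) (a b u : nat -> R) (C : R)
    : Prop :=
  forall x : nat -> R, nonneg_seq x -> nonincr_seq x ->
    hardy_lhs q a u x <= C%:E * hardy_rhs p b x.

(* [ereal_inf set0 = +oo], so this is +oo when no finite constant works. *)
Definition best_const (R : realType) (p q : R) (a b u : nat -> R) : \bar R :=
  ereal_inf [set C%:E | C in [set C : R | hardy_ineq p q a b u C]].

(* The library has [+oo `^ r = +oo] for [r < 0], but negative powers are only
   taken here of [seq_sum b] and [b 1], positive and finite under the
   hypotheses b 1 > 0 and [seq_sum b < +oo]. *)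
Definition C0 (R : realType) (p q : R) (a b u : nat -> R) : \bar R :=
  (\sum_(1 <= m <oo)
     tail_sup (fun i => u i * i%:R)%R m `^ q * (a m)%:E) `^ q^-1
  * seq_sum b `^ (- p^-1).

(* Main.v *)
(** Test the inequality on the constant sequence [1]: its left-hand side is
    [S = C0 * B^(1/p)] and its right-hand side is [B^(1/p)], which gives
    [C0 <= C].  Conversely a non-increasing [x] satisfies [x k <= x 1], so the
    left-hand side at [x] is at most [x 1 * S], while keeping only the first
    term of the right-hand side shows that it is at least [x 1 * (b 1)^(1/p)];
    hence the constant [S * (b 1)^(-1/p)] works. *)

Require Import Defs.
From mathcomp Require Import all_boot all_order all_algebra.
From mathcomp Require Import all_classical all_reals all_analysis.

Set Implicit Arguments.
Unset Strict Implicit.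
Unset Printing Implicit Defensive.

Import Order.TTheory GRing.Theory Num.Theory.

Local Open Scope ring_scope.
Local Open Scope ereal_scope.

Lemma tail_sup_ge0 (R : realType) (v : nat -> R) (m : nat) :
  nonneg_seq v -> (0 < m)%N -> 0 <= tail_sup v m.
Proof.
move=> v0 m0; apply: (@le_trans _ _ (v m)%:E); first by rewrite lee_fin v0.
by apply: ereal_sup_ubound; exists m => /=.
Qed.

(** Termwise bounds suffice, even when the supremum of [w] is infinite: for [c = 0] the right side
    is then [0 * +oo = 0], and [v] is non-positive from [m] on. *)
Lemma le_tail_sup (R : realType) (c : R) (v w : nat -> R) (m : nat) :
  (0 <= c)%R -> (forall i, (m <= i)%N -> (v i <= c * w i)%R) ->
  tail_sup v m <= c%:E * tail_sup w m.
Proof.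
move=> c0 vw; apply: ge_ereal_sup => _ [i /= mi <-].
apply: (@le_trans _ _ (c%:E * (w i)%:E)); first by rewrite -EFinM lee_fin vw.
by rewrite lee_wpmul2l ?lee_fin//; apply: ereal_sup_ubound; exists i.
Qed.

Lemma le_poweR (R : realType) (r : R) (x y : \bar R) :
  (0 <= r)%R -> 0 <= x -> x <= y -> x `^ r <= y `^ r.
Proof.
move=> r0 x0 xy; apply: gt0_ler_poweR => //; rewrite in_itv/= leey andbT//.
exact: le_trans xy.
Qed.

Lemma poweRVK (R : realType) (r : R) (x : \bar R) :
  (0 < r)%R -> 0 <= x -> (x `^ r) `^ r^-1 = x.
Proof. by move=> r0 x0; rewrite -poweRrM divff ?gt_eqF// poweRe1. Qed.

Lemma sum1_nat (R : realType) (n : nat) :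
  (\sum_(1 <= k < n.+1) 1 = n%:R :> R)%R.
Proof. by rewrite sumr_const_nat subn1. Qed.

Section HardyConstants.
Variables (R : realType) (p q : R) (a b u : nat -> R).
Hypotheses (p_gt0 : (0 < p)%R) (q_gt0 : (0 < q)%R).
Hypotheses (a_ge0 : nonneg_seq a) (b_ge0 : nonneg_seq b) (u_ge0 : nonneg_seq u).
Hypotheses (b1_gt0 : (0 < b 1%N)%R) (b_sum : seq_sum b < +oo).

Let one : nat -> R := fun=> 1%R.

Let one_ge0 : nonneg_seq one.
Proof. by move=> m _; exact: ler01. Qed.

Let one_nonincr : nonincr_seq one.
Proof. by move=> m n _ _; exact: lexx. Qed.

Lemma weighted_sum_ge0 (x : nat -> R) : nonneg_seq x ->
  nonneg_seq (fun i => u i * \sum_(1 <= k < i.+1) x k)%R.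
Proof.
move=> x0 i i0; rewrite mulr_ge0 ?u_ge0// big_nat_cond sumr_ge0// => k.
by rewrite andbT => /andP[k0 _]; exact: x0.
Qed.

Lemma hardy_lhs_le (x : nat -> R) : nonneg_seq x -> nonincr_seq x ->
  hardy_lhs q a u x <= (x 1%N)%:E * hardy_lhs q a u one.
Proof.
move=> x0 xd; have x10 : (0 <= x 1%N)%R by exact: x0.
(* Writing [x 1] as [(x 1 ^ q) ^ (1/q)] lets it pass under the outer root and then into the
   series. *)
rewrite /hardy_lhs -[X in X * _](poweRVK q_gt0) ?lee_fin//.
rewrite -poweRM ?poweR_ge0//; last first.
  by apply: nneseries_ge0 => m m0 _; rewrite mule_ge0 ?poweR_ge0// lee_fin a_ge0.
(* The lower index becomes a filter, which supplies [0 < m]: signs are known only at positive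
   indices. *)
rewrite poweR_EFin eseries_cond [in leRHS]eseries_cond -nneseriesZl; last first.
  by move=> m m0; rewrite mule_ge0 ?poweR_ge0// lee_fin a_ge0.
apply: le_poweR; first by rewrite invr_ge0 ltW.
  by apply: nneseries_ge0 => m _ m0; rewrite mule_ge0 ?poweR_ge0// lee_fin a_ge0.
apply: lee_nneseries => m => [_|] m0.
  by rewrite mule_ge0 ?poweR_ge0// lee_fin a_ge0.
rewrite muleA lee_wpmul2r ?lee_fin ?a_ge0//.
rewrite -poweR_EFin -poweRM ?lee_fin//; last first.
  by apply: tail_sup_ge0 => //; exact: weighted_sum_ge0.
apply: le_poweR; first exact: ltW.
  by apply: tail_sup_ge0 => //; exact: weighted_sum_ge0.
apply: le_tail_sup => // i mi; rewrite mulrCA ler_wpM2l ?u_ge0 ?(leq_trans m0)//.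
rewrite mulr_sumr; apply: ler_sum_nat => k /andP[k0 _].
by rewrite mulr1 xd.
Qed.

Lemma hardy_rhs_ge (x : nat -> R) : nonneg_seq x ->
  (x 1%N)%:E * (b 1%N)%:E `^ p^-1 <= hardy_rhs p b x.
Proof.
move=> x0; have x10 : (0 <= x 1%N)%R by exact: x0.
rewrite -[X in X * _](poweRVK p_gt0) ?lee_fin//.
rewrite -poweRM ?poweR_ge0 ?lee_fin ?b_ge0//.
apply: le_poweR; first by rewrite invr_ge0 ltW.
  by rewrite mule_ge0 ?poweR_ge0// lee_fin b_ge0.
(* The upper bound 2 is exclusive, so this partial sum is the single term of index 1. *)
apply: le_trans (nneseries_lim_ge 2 _).
  by rewrite big_nat1 poweR_EFin EFinM.
by move=> m m0 _; rewrite lee_fin mulr_ge0 ?powR_ge0// b_ge0.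
Qed.

Lemma C0E : C0 p q a b u = hardy_lhs q a u one * seq_sum b `^ (- p^-1).
Proof.
rewrite /C0 /hardy_lhs; congr (_ `^ _ * _).
apply: eq_eseriesr => m _; congr (tail_sup _ m `^ q * _).
by apply/funext => i; rewrite sum1_nat.
Qed.

Lemma hardy_rhs_one : hardy_rhs p b one = seq_sum b `^ p^-1.
Proof.
congr (_ `^ _); apply: eq_eseriesr => m _.
by rewrite powR1 mul1r.
Qed.

Lemma seq_sum_gt0 : 0 < seq_sum b.
Proof.
apply: (@lt_le_trans _ _ (b 1%N)%:E); first by rewrite lte_fin.
apply: le_trans (nneseries_lim_ge 2 _); first by rewrite big_nat1.
by move=> m m0 _; rewrite lee_fin b_ge0.
Qed.

Lemma seq_sum_fin : seq_sum b \is a fin_num.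
Proof. by rewrite ge0_fin_numE// ltW// seq_sum_gt0. Qed.

Lemma fine_seq_sum_gt0 : (0 < fine (seq_sum b))%R.
Proof. by rewrite fine_gt0// seq_sum_gt0 b_sum. Qed.

Lemma C0_le (C : R) : hardy_ineq p q a b u C -> C0 p q a b u <= C%:E.
Proof.
move=> /(_ one one_ge0 one_nonincr); rewrite hardy_rhs_one C0E.
(* Both powers of [seq_sum b] become positive reals, so the division is legitimate even if the
   left-hand side at [one] is infinite. *)
rewrite poweRN ?seq_sum_fin// -[X in _ <= _ * X `^ _](fineK seq_sum_fin) poweR_EFin.
by rewrite lee_pdivrMr// powR_gt0 ?fine_seq_sum_gt0.
Qed.

Lemma hardy_ineq_upper : hardy_lhs q a u one \is a fin_num ->
  hardy_ineq p q a b u (fine (hardy_lhs q a u one) * (b 1%N `^ p^-1)^-1)%R.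
Proof.
move=> Sfin x x0 xd; apply: le_trans (hardy_lhs_le x0 xd) _.
have b1p : (0 < b 1%N `^ p^-1)%R by rewrite powR_gt0.
have S0 : 0 <= hardy_lhs q a u one by exact: poweR_ge0.
(* Dropping the common non-negative factor [hardy_lhs q a u one] leaves exactly [hardy_rhs_ge]. *)
rewrite EFinM fineK// muleC -muleA lee_wpmul2l// lee_pdivlMl// muleC.
by have := hardy_rhs_ge x0; rewrite poweR_EFin.
Qed.

(** The other factor of [C0] is a strictly positive real, so it cannot absorb an infinite left-hand
    side. *)
Lemma C0_lty : C0 p q a b u < +oo -> hardy_lhs q a u one \is a fin_num.
Proof.
have S0 : 0 <= hardy_lhs q a u one by exact: poweR_ge0.
rewrite ge0_fin_numE// C0E poweRN ?seq_sum_fin//.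
case: (hardy_lhs q a u one) S0 => [s _ _|_|//]; first exact: ltry.
by rewrite gt0_mulye// lte_fin invr_gt0 powR_gt0// fine_seq_sum_gt0.
Qed.

End HardyConstants.

Theorem theorem2p1 (R : realType) (p q : R) (a b u : nat -> R)
    (p_gt0 : (0 < p)%R) (q_gt0 : (0 < q)%R)
    (a_ge0 : nonneg_seq a) (b_ge0 : nonneg_seq b) (u_ge0 : nonneg_seq u)
    (b1_gt0 : (0 < b 1%N)%R) (b_sum : seq_sum b < +oo) :
  ((exists C : R, hardy_ineq p q a b u C) <-> C0 p q a b u < +oo)
  /\ C0 p q a b u <= best_const p q a b u
  /\ best_const p q a b u
       <= C0 p q a b u * (b 1%N)%:E `^ (- p^-1) * seq_sum b `^ p^-1.
Proof.
have upper : C0 p q a b u < +oo -> _ :=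
  fun h => hardy_ineq_upper p_gt0 q_gt0 a_ge0 b_ge0 u_ge0 b1_gt0
    (C0_lty b_ge0 b1_gt0 b_sum h).
have Bfin := seq_sum_fin b_ge0 b1_gt0 b_sum.
have B0 : (0 < fine (seq_sum b) `^ p^-1)%R.
  by apply: powR_gt0; exact: fine_seq_sum_gt0.
split; first split.
- by move=> [C /(C0_le b_ge0 b1_gt0 b_sum) C0C]; exact: le_lt_trans C0C (ltry _).
- by move=> /upper hC; exact: ex_intro hC.
split.
  (* [C0] bounds every admissible constant from below; this includes the empty case, where the
     infimum is [+oo]. *)
  by apply: le_ereal_inf_tmp => _ [C hC <-]; exact: C0_le.
have [C0oo|] := ltP (C0 p q a b u) +oo; last first.
  (* With [C0] infinite the upper bound is [+oo], since both remaining factors are positive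
     reals. *)
  rewrite leye_eq => /eqP ->; rewrite poweR_EFin -(fineK Bfin) poweR_EFin.
  by rewrite gt0_mulye ?lte_fin ?powR_gt0// gt0_mulye ?leey.
apply: (@le_trans _ _
  (fine (hardy_lhs q a u (fun=> 1%R)) * (b 1%N `^ p^-1)^-1)%:E).
  by apply: ereal_inf_lbound; exact: ex_intro2 (upper C0oo) erefl.
have Sfin := C0_lty b_ge0 b1_gt0 b_sum C0oo.
(* All factors are now real, the two opposite powers of [seq_sum b] cancel, and the bound equals the
   constant of [hardy_ineq_upper]. *)
rewrite C0E poweRN// [X in _ <= _ * X * _]poweRN//= -(fineK Sfin).
rewrite -[X in _ <= _ * X `^ p^-1](fineK Bfin) poweR_EFin -!EFinM lee_fin.
by rewrite mulrAC -[X in (_ <= X * _)%R]mulrA mulVf ?gt_eqF// mulr1.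
Qed.
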